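(* Let $\lambda\in\mathbf k$ and let $(A,\cdot,\partial)$ be a differential algebra of weight $\lambda$. Let $\eth:A\to A$ be a linear map and suppose that $(A^*,\circ,\eth^* )$ is a differential algebra of weight $\lambda$ on the dual space $A^*$. Let $\Delta:A\to A\otimes A$ be the linear dual of the multiplication $\circ$. Then the following statements are equivalent: (a) The sextuple $((A,\partial),(A^*,\eth^* ),R_\cdot^*,L_\cdot^*,R_\circ^*,L_\circ^* )$ is a matched pair of differential algebras of weight $\lambda$. (b) There is a double construction $(A\bowtie A^*,\star,\partial+\eth^*,\mathfrak B_d)$ of differential Frobenius algebras of weight $\lambda$ associated to $(A,\cdot,\partial)$ and $(A^*,\circ,\eth^* )$. (c) The quintuple $(A,\cdot,\Delta,\partial,\eth)$ is a differential antisymmetric infinitesimal bialgebra of weight $\lambda$.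
   Context: $\mathbf k$ is a field of characteristic $0$; all vector spaces and algebras are finite-dimensional over $\mathbf k$; ''algebra'' means associative algebra, not necessarily commutative or unital; $A^{**}=A$. $L_\cdot(x)y=x\cdot y=R_\cdot(y)x$. For $\rho:A\to\mathrm{End}(V)$, $\rho^*:A\to\mathrm{End}(V^* )$ is given by $\langle\rho^*(x)u^*,v\rangle=\langle u^*,\rho(x)v\rangle$; for a linear map $\psi$, $\psi^*$ is its transpose. The linear dual $\Delta$ of $\circ$ is defined by $\langle a^*\otimes b^*,\Delta(x)\rangle=\langle a^*\circ b^*,x\rangle$. $\sigma(x\otimes y)=y\otimes x$. Differential algebra of weight $\lambda$: an algebra $(A,\cdot)$ with a linear map $\partial$ such that $\partial(xy)=\partial(x)y+x\partial(y)+\lambda\partial(x)\partial(y)$. Differential coalgebra of weight $\lambda$: a coassociative coalgebra $(A,\Delta)$ (no counit required) with a linear map $\eth$ such that $\Delta\eth=(\eth\otimes\mathrm{id}+\mathrm{id}\otimes\eth+\lambda\eth\otimes\eth)\Delta$. Admissible differential algebra $(A,\cdot,\partial,\eth)$ of weight $\lambda$: $(A,\cdot,\partial)$ is a differential algebra of weight $\lambda$ and $\eth:A\to A$ is linear with $\eth(x)y=x\partial(y)+\eth(xy)+\lambda\eth(x\partial(y))$ and $x\eth(y)=\partial(x)y+\eth(xy)+\lambda\eth(\partial(x)y)$. Admissible differential coalgebra $(A,\Delta,\eth,\partial)$ of weight $\lambda$: $(A,\Delta,\eth)$ is a differential coalgebra of weight $\lambda$ and $\partial:A\to A$ is linear with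 $(\partial\otimes\mathrm{id})\Delta=(\mathrm{id}\otimes\eth)\Delta+\Delta\partial+\lambda(\mathrm{id}\otimes\eth)\Delta\partial$ and $(\mathrm{id}\otimes\partial)\Delta=(\eth\otimes\mathrm{id})\Delta+\Delta\partial+\lambda(\eth\otimes\mathrm{id})\Delta\partial$. Antisymmetric infinitesimal (ASI) bialgebra $(A,\cdot,\Delta)$: an algebra and coassociative coalgebra with $\Delta(xy)=(R_\cdot(y)\otimes\mathrm{id})\Delta(x)+(\mathrm{id}\otimes L_\cdot(x))\Delta(y)$ and $(L_\cdot(x)\otimes\mathrm{id}-\mathrm{id}\otimes R_\cdot(x))\Delta(y)=\sigma\big((\mathrm{id}\otimes R_\cdot(y)-L_\cdot(y)\otimes\mathrm{id})\Delta(x)\big)$. Differential antisymmetric infinitesimal bialgebra of weight $\lambda$: $(A,\cdot,\Delta,\partial,\eth)$ such that $(A,\cdot,\Delta)$ is an ASI bialgebra, $(A,\cdot,\partial,\eth)$ is an admissible differential algebra of weight $\lambda$, and $(A,\Delta,\eth,\partial)$ is an admissible differential coalgebra of weight $\lambda$. Representation $(V,\ell,r)$ of an algebra $A$: linear $\ell,r:A\to\mathrm{End}(V)$ with $\ell(xy)=\ell(x)\ell(y)$, $r(xy)=r(y)r(x)$, $\ell(x)r(y)=r(y)\ell(x)$. Representation $(V,\ell,r,\theta)$ of a differential algebra $(A,\cdot,\partial)$ of weight $\lambda$: $(V,\ell,r)$ is a representation of $A$ and $\theta:V\to V$ is linear with $\theta(\ell(x)v)=\ell(\partial(x))v+\ell(x)\theta(v)+\lambda\ell(\partial(x))\theta(v)$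 and $\theta(r(x)v)=r(\partial(x))v+r(x)\theta(v)+\lambda r(\partial(x))\theta(v)$. Matched pair of algebras $(A,B,\ell_A,r_A,\ell_B,r_B)$: algebras $A,B$ and linear maps $\ell_A,r_A:A\to\mathrm{End}(B)$, $\ell_B,r_B:B\to\mathrm{End}(A)$ such that $(A,\ell_B,r_B)$ is a representation of $B$, $(B,\ell_A,r_A)$ is a representation of $A$, and $(a+b)(a'+b')=(aa'+r_B(b')a+\ell_B(b)a')+(bb'+\ell_A(a)b'+r_A(a')b)$ is an associative product on $A\oplus B$. Matched pair of differential algebras of weight $\lambda$, $((A,\partial_A),(B,\partial_B),\ell_A,r_A,\ell_B,r_B)$: $(A,\partial_A),(B,\partial_B)$ are differential algebras of weight $\lambda$, $(A,B,\ell_A,r_A,\ell_B,r_B)$ is a matched pair of algebras, $(B,\ell_A,r_A,\partial_B)$ is a representation of $(A,\partial_A)$ and $(A,\ell_B,r_B,\partial_A)$ is a representation of $(B,\partial_B)$. Double construction of Frobenius algebras $(A\bowtie A^*,\star,\mathfrak B_d)$ associated to $(A,\cdot)$ and $(A^*,\circ)$: an algebra structure $\star$ on $A\oplus A^*$ containing $(A,\cdot)$ and $(A^*,\circ)$ as subalgebras such that $\mathfrak B_d(x+a^*,y+b^* )=\langle x,b^*\rangle+\langle a^*,y\rangle$ is invariant, i.e. $\mathfrak B_d(uv,w)=\mathfrak B_d(u,vw)$ with product $\star$. It is a double construction of differential Frobenius algebras of weight $\lambda$ associated to $(A,\cdot,\partial)$ and $(A^*,\circ,\eth^* )$ if moreover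 $(A\oplus A^*,\star,\partial+\eth^* )$ is a differential algebra of weight $\lambda$, where $(\partial+\eth^* )(x+a^* )=\partial(x)+\eth^*(a^* )$. *)

(* Defs.v *)
From HB Require Import structures.
From mathcomp Require Import all_boot all_algebra.

Set Implicit Arguments.
Unset Strict Implicit.
Unset Printing Implicit Defensive.

Import GRing.Theory.
Local Open Scope ring_scope.

(* Bilinear maps A x B -> C are elements of 'Hom(A, 'Hom(B, C)).  [bilfun f]
   bundles a Rocq function f; it agrees with f when f is bilinear (bilfunE). *)
Definition bilfun (k : fieldType) (A B C : vectType k) (f : A -> B -> C) :
  'Hom(A, 'Hom(B, C)) := linfun (fun x => linfun (f x)).

Lemma linfunE (k : fieldType) (A B : vectType k) (f : A -> B) :
  linear f -> linfun f =1 f.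
Proof.
move=> fl x; pose fM := GRing.isLinear.Build k A B *:%R f fl.
pose F : {linear A -> B} := HB.pack f fM.
exact: (lfunE F x).
Qed.

Lemma bilfunE (k : fieldType) (A B C : vectType k) (f : A -> B -> C) :
  (forall x, linear (f x)) -> (forall y, linear (f^~ y)) ->
  forall x y, bilfun f x y = f x y.
Proof.
move=> fr fl x y; rewrite /bilfun linfunE; first by rewrite linfunE.
move=> c u v; apply/lfunP=> w.
by rewrite add_lfunE scale_lfunE !linfunE //; apply: (fl w).
Qed.

Definition dual (k : fieldType) (A : vectType k) : Type := 'Hom(A, k^o).

HB.instance Definition _ (k : fieldType) (A : vectType k) :=
  Vector.copy (dual A) 'Hom(A, k^o).

Definition transp (k : fieldType) (A B : vectType k) (f : 'Hom(A, B)) :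
  'Hom(dual B, dual A) := linfun (fun u : dual B => (u \o f)%VF).

Lemma transpE (k : fieldType) (A B : vectType k) (f : 'Hom(A, B))
  (u : dual B) (x : A) : transp f u x = u (f x).
Proof.
rewrite linfunE ?comp_lfunE // => c v w.
by rewrite comp_lfunDl comp_lfunZl.
Qed.

Definition ev (k : fieldType) (A : vectType k) : 'Hom(A, dual (dual A)) :=
  bilfun (fun (x : A) (u : dual A) => u x : k^o).

Lemma evE (k : fieldType) (A : vectType k) (x : A) (u : dual A) :
  ev A x u = u x.
Proof.
rewrite bilfunE // => [y c v w|v c y z]; first by rewrite add_lfunE scale_lfunE.
by rewrite linearP.
Qed.

Definition dbasis (k : fieldType) (A : vectType k) i : dual A :=
  linfun (coord (vbasis {:A}) i : A -> k^o).

Lemma dbasisE (k : fieldType) (A : vectType k) (x : A) :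
  x = \sum_i dbasis i x *: (vbasis {:A})`_i.
Proof.
rewrite {1}(coord_vbasis (memvf x)); apply: eq_bigr => i _.
by rewrite linfunE // => c u v; rewrite linearP.
Qed.

Lemma dbasis_dual (k : fieldType) (A : vectType k) (u : dual A) :
  u = \sum_(i < \dim {:A}) u (vbasis {:A})`_i *: dbasis i.
Proof.
apply/lfunP => x; rewrite {1}(dbasisE x) linear_sum sum_lfunE.
by apply: eq_bigr => i _; rewrite linearZ scale_lfunE; apply: mulrC.
Qed.

Lemma ev_lker0 (k : fieldType) (A : vectType k) : lker (ev A) == 0%VS.
Proof.
apply/lker0P => x y exy; rewrite (dbasisE x) (dbasisE y).
by apply: eq_bigr => i _; rewrite -(evE x) exy evE.
Qed.

Lemma ev_surj (k : fieldType) (A : vectType k) (phi : dual (dual A)) :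
  phi = ev A (\sum_i phi (dbasis i) *: (vbasis {:A})`_i).
Proof.
apply/lfunP => u; rewrite evE {1}(dbasis_dual u) !linear_sum.
by apply: eq_bigr => i _; rewrite !linearZ; apply: mulrC.
Qed.

Lemma ev_invK (k : fieldType) (A : vectType k) :
  cancel (ev A)^-1%VF (ev A).
Proof. by move=> phi; rewrite (ev_surj phi) lker0_lfunK ?ev_lker0. Qed.

Definition dual_rep (k : fieldType) (A V : vectType k) (rho : 'Hom(A, 'End(V))) :
  'Hom(A, 'End(dual V)) := linfun (fun x => transp (rho x)).

Lemma dual_repE (k : fieldType) (A V : vectType k) (rho : 'Hom(A, 'End(V)))
  (x : A) (u : dual V) (v : V) : dual_rep rho x u v = u (rho x v).
Proof.
rewrite linfunE ?transpE // => c y z; apply/lfunP => w; apply/lfunP => t.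
rewrite add_lfunE scale_lfunE add_lfunE scale_lfunE !transpE linearP.
by rewrite add_lfunE scale_lfunE linearP.
Qed.

(* Transport along the canonical isomorphism ev : V -> V**. *)
Definition of_bidual (k : fieldType) (B V : vectType k)
  (rho : 'Hom(B, 'End(dual (dual V)))) : 'Hom(B, 'End(V)) :=
  linfun (fun b => ((ev V)^-1 \o rho b \o ev V)%VF).

Lemma of_bidualE (k : fieldType) (B V : vectType k)
  (rho : 'Hom(B, 'End(dual (dual V)))) (b : B) (x : V) :
  ev V (of_bidual rho b x) = rho b (ev V x).
Proof.
rewrite [of_bidual _ _]linfunE ?comp_lfunE ?ev_invK // => c y z.
by rewrite linearP comp_lfunDr comp_lfunDl -comp_lfunZr -comp_lfunZl.
Qed.

Lemma of_bidual_dualE (k : fieldType) (B V : vectType k)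
  (rho : 'Hom(B, 'End(dual V))) (b : B) (x : V) (u : dual V) :
  u (of_bidual (dual_rep rho) b x) = rho b u x.
Proof.
rewrite -[LHS](evE (of_bidual (dual_rep rho) b x) u) (of_bidualE (dual_rep rho)).
by rewrite (dual_repE rho b (ev V x) u) (evE x).
Qed.

(* For finite-dimensional A and B, the tensor product of A and B is realised
   as the space of bilinear forms on A* x B*; tens_univ below is its universal
   property.  The pairing < u (x) v, T > is then T u v. *)
Definition tensor (k : fieldType) (A B : vectType k) : Type :=
  'Hom(dual A, dual (dual B)).

HB.instance Definition _ (k : fieldType) (A B : vectType k) :=
  Vector.copy (tensor A B) 'Hom(dual A, dual (dual B)).

Definition tens (k : fieldType) (A B : vectType k) (x : A) (y : B) :
  tensor A B := bilfun (fun (u : dual A) (v : dual B) => u x * v y : k^o).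

Lemma tensE (k : fieldType) (A B : vectType k) (x : A) (y : B)
  (u : dual A) (v : dual B) : tens x y u v = u x * v y.
Proof.
rewrite bilfunE // => [w c s t|w c s t]; rewrite add_lfunE scale_lfunE.
  by rewrite mulrDr /= mulrCA.
by rewrite mulrDl /= -mulrA.
Qed.

Lemma tens_decomp (k : fieldType) (A B : vectType k) (T : tensor A B) :
  T = \sum_i \sum_j T (dbasis i) (dbasis j)
        *: tens (vbasis {:A})`_i (vbasis {:B})`_j.
Proof.
apply/lfunP => u; apply/lfunP => v.
rewrite {1}(dbasis_dual u) linear_sum !sum_lfunE; apply: eq_bigr => i _.
rewrite linearZ scale_lfunE {1}(dbasis_dual v) linear_sum scaler_sumr.
rewrite !sum_lfunE.
apply: eq_bigr => j _; rewrite linearZ /= !scale_lfunE tensE.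
by rewrite scalerA; apply: mulrC.
Qed.

Lemma tens_univ (k : fieldType) (A B W : vectType k) (f : 'Hom(A, 'Hom(B, W))) :
  exists! g : 'Hom(tensor A B, W), forall x y, g (tens x y) = f x y.
Proof.
pose G (T : tensor A B) : W := \sum_i \sum_j T (dbasis i) (dbasis j)
        *: f (vbasis {:A})`_i (vbasis {:B})`_j.
have Gl : linear G.
  move=> c S T; rewrite /G scaler_sumr -big_split; apply: eq_bigr => i _ /=.
  rewrite scaler_sumr -big_split; apply: eq_bigr => j _ /=.
  by rewrite !(add_lfunE, scale_lfunE) scalerDl scalerA.
exists (linfun G); split=> [x y | g gE].
  rewrite linfunE // /G {2}(dbasisE x) linear_sum sum_lfunE.
  apply: eq_bigr => i _; rewrite linearZ scale_lfunE {2}(dbasisE y) linear_sum.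
  rewrite scaler_sumr; apply: eq_bigr => j _.
  by rewrite tensE linearZ scalerA.
apply/lfunP => T; rewrite linfunE // [in RHS](tens_decomp T) linear_sum.
apply: eq_bigr => i _; rewrite linear_sum; apply: eq_bigr => j _.
by rewrite linearZ /= gE.
Qed.

Definition tpair (k : fieldType) (A B : vectType k) (u : dual A) (v : dual B) :
  dual (tensor A B) := linfun (fun T : tensor A B => T u v).

Lemma tpairE (k : fieldType) (A B : vectType k) (u : dual A) (v : dual B)
  (T : tensor A B) : tpair u v T = T u v.
Proof. by rewrite linfunE // => c S T'; rewrite !(add_lfunE, scale_lfunE). Qed.

Lemma tpair_tens (k : fieldType) (A B : vectType k) (u : dual A) (v : dual B)
  (x : A) (y : B) : tpair u v (tens x y) = u x * v y.
Proof. by rewrite tpairE tensE. Qed.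

Definition tmap (k : fieldType) (A B C D : vectType k)
  (f : 'Hom(A, C)) (g : 'Hom(B, D)) : 'Hom(tensor A B, tensor C D) :=
  linfun (fun T : tensor A B => (transp (transp g) \o T \o transp f)%VF).

Lemma tmapE (k : fieldType) (A B C D : vectType k)
  (f : 'Hom(A, C)) (g : 'Hom(B, D)) (T : tensor A B)
  (u : dual C) (v : dual D) :
  tmap f g T u v = T (transp f u) (transp g v).
Proof.
rewrite linfunE ?comp_lfunE ?transpE // => c S T'.
by rewrite comp_lfunDr comp_lfunDl -comp_lfunZr -comp_lfunZl.
Qed.

Lemma tmap_tens (k : fieldType) (A B C D : vectType k)
  (f : 'Hom(A, C)) (g : 'Hom(B, D)) (x : A) (y : B) :
  tmap f g (tens x y) = tens (f x) (g y).
Proof.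
apply/lfunP => u; apply/lfunP => v.
by rewrite tmapE !tensE !transpE.
Qed.

Definition tswap (k : fieldType) (A B : vectType k) :
  'Hom(tensor A B, tensor B A) :=
  linfun (fun T : tensor A B =>
    bilfun (fun (v : dual B) (u : dual A) => T u v : k^o)).

Lemma tswapE (k : fieldType) (A B : vectType k) (T : tensor A B)
  (u : dual A) (v : dual B) : tswap A B T v u = T u v.
Proof.
have E (S : tensor A B) (s : dual A) (t : dual B) :
    bilfun (fun (v : dual B) (u : dual A) => S u v : k^o) t s = S s t.
  rewrite bilfunE // => [w c y z|w c y z]; last by rewrite linearP.
  by rewrite linearP add_lfunE scale_lfunE.
rewrite linfunE ?E // => c S S'; apply/lfunP => t; apply/lfunP => s.
by rewrite !(add_lfunE, scale_lfunE) !E !(add_lfunE, scale_lfunE).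
Qed.

Lemma tswap_tens (k : fieldType) (A B : vectType k) (x : A) (y : B) :
  tswap A B (tens x y) = tens y x.
Proof.
apply/lfunP => u; apply/lfunP => v.
by rewrite tswapE !tensE mulrC.
Qed.

(* The associativity isomorphism: an element of (A (x) B) (x) C is sent to the
   form whose first argument u is contracted with A, leaving an element of
   B (x) C that is then evaluated on w : (B (x) C)*; see tassoc_tens. *)
Definition tassoc (k : fieldType) (A B C : vectType k) :
  'Hom(tensor (tensor A B) C, tensor A (tensor B C)) :=
  linfun (fun T : tensor (tensor A B) C =>
    bilfun (fun (u : dual A) (w : dual (tensor B C)) =>
      w (linfun (fun v : dual B => T (tpair u v))) : k^o)).

Lemma tpair_linearl (k : fieldType) (A B : vectType k) (v : dual B) :
  linear (fun u : dual A => tpair u v).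
Proof.
move=> c s t; apply/lfunP => T.
by rewrite add_lfunE scale_lfunE !tpairE linearP add_lfunE scale_lfunE.
Qed.

Lemma tpair_linearr (k : fieldType) (A B : vectType k) (u : dual A) :
  linear (fun v : dual B => tpair u v).
Proof.
move=> c s t; apply/lfunP => T.
by rewrite add_lfunE scale_lfunE !tpairE linearP.
Qed.

Lemma tassocE (k : fieldType) (A B C : vectType k)
  (T : tensor (tensor A B) C) (u : dual A) (v : dual B) (w : dual C) :
  tassoc A B C T u (tpair v w) = T (tpair u v) w.
Proof.
have E0 (S : tensor (tensor A B) C) (s : dual A) (t : dual B) :
    linfun (fun v : dual B => S (tpair s v)) t = S (tpair s t).
  by rewrite linfunE // => c y z; rewrite tpair_linearr linearP.
have E (S : tensor (tensor A B) C) (s : dual A) (t : dual (tensor B C)) :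
    bilfun (fun (u : dual A) (w : dual (tensor B C)) =>
      w (linfun (fun v : dual B => S (tpair u v))) : k^o) s t
    = t (linfun (fun v : dual B => S (tpair s v))).
  rewrite bilfunE // => [y c p q|y c p q]; first by rewrite add_lfunE scale_lfunE.
  rewrite -linearP; congr (y _); apply/lfunP => b.
  by rewrite add_lfunE scale_lfunE !E0 tpair_linearl linearP.
rewrite linfunE => [|c S S']; first by rewrite E tpairE E0.
apply/lfunP => p; apply/lfunP => q.
rewrite !(add_lfunE, scale_lfunE) !E -linearP; congr (q _); apply/lfunP => b.
by rewrite !(add_lfunE, scale_lfunE) !E0 !(add_lfunE, scale_lfunE).
Qed.

Lemma dual_tens_decomp (k : fieldType) (A B : vectType k)
  (w : dual (tensor A B)) :
  w = \sum_(i < \dim {:A}) \sum_(j < \dim {:B})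
        w (tens (vbasis {:A})`_i (vbasis {:B})`_j)
        *: tpair (dbasis i) (dbasis j).
Proof.
apply/lfunP => T; rewrite {1}(tens_decomp T) linear_sum sum_lfunE.
apply: eq_bigr => i _; rewrite linear_sum sum_lfunE; apply: eq_bigr => j _.
by rewrite linearZ scale_lfunE tpairE; apply: mulrC.
Qed.

Lemma tassoc_tens (k : fieldType) (A B C : vectType k) (x : A) (y : B) (z : C) :
  tassoc A B C (tens (tens x y) z) = tens x (tens y z).
Proof.
apply/lfunP => u; apply/lfunP => w; rewrite (dual_tens_decomp w) !linear_sum.
apply: eq_bigr => i _; rewrite !linear_sum; apply: eq_bigr => j _.
by rewrite !linearZ /= tassocE !tensE !tpair_tens mulrA.
Qed.

(* A multiplication is a bilinear map dot : 'Hom(A, 'End(A)), so that dot x is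
   the left multiplication operator L(x); rmult dot y is R(y). *)
Definition lmult (k : fieldType) (A : vectType k) (dot : 'Hom(A, 'End(A))) :
  'Hom(A, 'End(A)) := dot.

Definition rmult (k : fieldType) (A : vectType k) (dot : 'Hom(A, 'End(A))) :
  'Hom(A, 'End(A)) := bilfun (fun y x => dot x y).

Lemma rmultE (k : fieldType) (A : vectType k) (dot : 'Hom(A, 'End(A))) (x y : A) :
  rmult dot y x = dot x y.
Proof.
rewrite bilfunE // => [t c u v|t c u v]; last by rewrite linearP.
by rewrite linearP add_lfunE scale_lfunE.
Qed.

Definition is_algebra (k : fieldType) (A : vectType k)
  (dot : 'Hom(A, 'End(A))) : Prop :=
  associative (fun x y => dot x y).

Definition is_diff_algebra (k : fieldType) (lambda : k) (A : vectType k)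
  (dot : 'Hom(A, 'End(A))) (d : 'End(A)) : Prop :=
  is_algebra dot /\
  forall x y, d (dot x y) =
    dot (d x) y + dot x (d y) + lambda *: dot (d x) (d y).

Definition is_admissible_diff_algebra (k : fieldType) (lambda : k)
  (A : vectType k) (dot : 'Hom(A, 'End(A))) (d eth : 'End(A)) : Prop :=
  [/\ is_diff_algebra lambda dot d,
      forall x y, dot (eth x) y =
        dot x (d y) + eth (dot x y) + lambda *: eth (dot x (d y)) &
      forall x y, dot x (eth y) =
        dot (d x) y + eth (dot x y) + lambda *: eth (dot (d x) y)].

Definition is_coalgebra (k : fieldType) (A : vectType k)
  (Delta : 'Hom(A, tensor A A)) : Prop :=
  forall x, tassoc A A A (tmap Delta \1 (Delta x)) = tmap \1 Delta (Delta x).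

Definition is_diff_coalgebra (k : fieldType) (lambda : k) (A : vectType k)
  (Delta : 'Hom(A, tensor A A)) (eth : 'End(A)) : Prop :=
  is_coalgebra Delta /\
  forall x, Delta (eth x) =
    tmap eth \1 (Delta x) + tmap \1 eth (Delta x)
    + lambda *: tmap eth eth (Delta x).

Definition is_admissible_diff_coalgebra (k : fieldType) (lambda : k)
  (A : vectType k) (Delta : 'Hom(A, tensor A A)) (eth d : 'End(A)) : Prop :=
  [/\ is_diff_coalgebra lambda Delta eth,
      forall x, tmap d \1 (Delta x) =
        tmap \1 eth (Delta x) + Delta (d x)
        + lambda *: tmap \1 eth (Delta (d x)) &
      forall x, tmap \1 d (Delta x) =
        tmap eth \1 (Delta x) + Delta (d x)
        + lambda *: tmap eth \1 (Delta (d x))].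

(* < a (x) b, Delta x > = < a o b, x >, see linear_dualE. *)
Definition linear_dual (k : fieldType) (A : vectType k)
  (circ : 'Hom(dual A, 'End(dual A))) : 'Hom(A, tensor A A) :=
  linfun (fun x : A =>
    bilfun (fun a b : dual A => circ a b x : k^o) : tensor A A).

Lemma linear_dualE (k : fieldType) (A : vectType k)
  (circ : 'Hom(dual A, 'End(dual A))) (x : A) (a b : dual A) :
  tpair a b (linear_dual circ x) = circ a b x.
Proof.
have E y (s t : dual A) :
    bilfun (fun a b : dual A => circ a b y : k^o) s t = circ s t y.
  rewrite bilfunE // => [w c p q|w c p q]; first by
    rewrite linearP add_lfunE scale_lfunE.
  by rewrite linearP !(add_lfunE, scale_lfunE).
rewrite tpairE linfunE ?E // => c y z; apply/lfunP => s; apply/lfunP => t.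
by rewrite !(add_lfunE, scale_lfunE) !E linearP.
Qed.

Definition is_ASI_bialgebra (k : fieldType) (A : vectType k)
  (dot : 'Hom(A, 'End(A))) (Delta : 'Hom(A, tensor A A)) : Prop :=
  [/\ is_algebra dot,
      is_coalgebra Delta,
      forall x y, Delta (dot x y) =
        tmap (rmult dot y) \1 (Delta x) + tmap \1 (lmult dot x) (Delta y) &
      forall x y,
        (tmap (lmult dot x) \1 - tmap \1 (rmult dot x)) (Delta y) =
        tswap A A
          ((tmap \1 (rmult dot y) - tmap (lmult dot y) \1) (Delta x))].

Definition is_diff_ASI_bialgebra (k : fieldType) (lambda : k) (A : vectType k)
  (dot : 'Hom(A, 'End(A))) (Delta : 'Hom(A, tensor A A)) (d eth : 'End(A)) :
  Prop :=
  [/\ is_ASI_bialgebra dot Delta,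
      is_admissible_diff_algebra lambda dot d eth &
      is_admissible_diff_coalgebra lambda Delta eth d].

Definition is_rep (k : fieldType) (A V : vectType k) (dot : 'Hom(A, 'End(A)))
  (l r : 'Hom(A, 'End(V))) : Prop :=
  [/\ forall x y, l (dot x y) = (l x \o l y)%VF,
      forall x y, r (dot x y) = (r y \o r x)%VF &
      forall x y, (l x \o r y)%VF = (r y \o l x)%VF].

Definition is_diff_rep (k : fieldType) (lambda : k) (A V : vectType k)
  (dot : 'Hom(A, 'End(A))) (d : 'End(A)) (l r : 'Hom(A, 'End(V)))
  (theta : 'End(V)) : Prop :=
  [/\ is_rep dot l r,
      forall x v, theta (l x v) =
        l (d x) v + l x (theta v) + lambda *: l (d x) (theta v) &
      forall x v, theta (r x v) =
        r (d x) v + r x (theta v) + lambda *: r (d x) (theta v)].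

Definition bowtie (k : fieldType) (A B : vectType k)
  (dotA : 'Hom(A, 'End(A))) (dotB : 'Hom(B, 'End(B)))
  (lA rA : 'Hom(A, 'End(B))) (lB rB : 'Hom(B, 'End(A))) (p q : A * B) : A * B :=
  (dotA p.1 q.1 + rB q.2 p.1 + lB p.2 q.1,
   dotB p.2 q.2 + lA p.1 q.2 + rA q.1 p.2).

Definition is_matched_pair (k : fieldType) (A B : vectType k)
  (dotA : 'Hom(A, 'End(A))) (dotB : 'Hom(B, 'End(B)))
  (lA rA : 'Hom(A, 'End(B))) (lB rB : 'Hom(B, 'End(A))) : Prop :=
  [/\ is_algebra dotA,
      is_algebra dotB,
      is_rep dotB lB rB,
      is_rep dotA lA rA &
      associative (bowtie dotA dotB lA rA lB rB)].

Definition is_diff_matched_pair (k : fieldType) (lambda : k) (A B : vectType k)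
  (dotA : 'Hom(A, 'End(A))) (dA : 'End(A))
  (dotB : 'Hom(B, 'End(B))) (dB : 'End(B))
  (lA rA : 'Hom(A, 'End(B))) (lB rB : 'Hom(B, 'End(A))) : Prop :=
  [/\ is_diff_algebra lambda dotA dA,
      is_diff_algebra lambda dotB dB,
      is_matched_pair dotA dotB lA rA lB rB,
      is_diff_rep lambda dotA dA lA rA dB &
      is_diff_rep lambda dotB dB lB rB dA].

Definition Bd (k : fieldType) (A : vectType k) (p q : A * dual A) : k :=
  q.2 p.1 + p.2 q.1.

Definition dsum (k : fieldType) (A B : vectType k) (f : 'End(A)) (g : 'End(B)) :
  'End((A * B)%type) := linfun (fun p : A * B => (f p.1, g p.2)).

Lemma dsumE (k : fieldType) (A B : vectType k) (f : 'End(A)) (g : 'End(B))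
  (p : A * B) : dsum f g p = (f p.1, g p.2).
Proof. by rewrite linfunE // => c x y; rewrite !linearP. Qed.

Definition is_double_construction (k : fieldType) (A : vectType k)
  (dot : 'Hom(A, 'End(A))) (circ : 'Hom(dual A, 'End(dual A)))
  (star : 'Hom((A * dual A)%type, 'End((A * dual A)%type))) : Prop :=
  [/\ is_algebra star,
      forall x y : A, star (x, 0) (y, 0) = (dot x y, 0),
      forall a b : dual A, star (0, a) (0, b) = (0, circ a b) &
      forall u v w, Bd (star u v) w = Bd u (star v w)].

Definition is_diff_double_construction (k : fieldType) (lambda : k)
  (A : vectType k) (dot : 'Hom(A, 'End(A))) (d : 'End(A))
  (circ : 'Hom(dual A, 'End(dual A))) (d' : 'End(dual A))
  (star : 'Hom((A * dual A)%type, 'End((A * dual A)%type))) : Prop :=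
  is_double_construction dot circ star /\
  is_diff_algebra lambda star (dsum d d').

(* Main.v *)
Require Import Defs.
From mathcomp Require Import all_boot all_algebra.
From mathcomp Require Import ssrAC ring.

Set Implicit Arguments.
Unset Strict Implicit.
Unset Printing Implicit Defensive.

Import GRing.Theory.
Local Open Scope ring_scope.

(** Everything is reduced to the bowtie product [bt] on A + A*, whose mixed part
    is given by the four dual actions.

    Why (a) and (b) agree: a matched pair of differential algebras is nothing
    but an associative bowtie product for which dA + dB is a derivation of
    weight lambda ([matched_pairP], [bowtie_derivationP]): reading associativity
    and the derivation rule on homogeneous elements, one component at a time,
    gives back all the representation axioms.  For the dual actions the form
    Bd is invariant under [bt], so (a) gives (b).  Conversely a double
    construction has no freedom.  The trilinear form Bd (u v) w is cyclic,
    because Bd is symmetric and invariant; among three homogeneous arguments two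
    cyclically adjacent ones lie in the same summand, and there the product is
    prescribed.  Since Bd is nondegenerate, the product must be [bt]
    ([double_construction_bowtie]).

    Why (a) and (c) agree: again by invariance, associativity of [bt] says that
    the quadrilinear form F (p, q, r, s) = Bd (p q) (r s) is unchanged by the
    cyclic shift of its arguments ([bowtie_assoc_cyclic]).  On homogeneous
    arguments, up to rotation, the words A A A A and A* A* A* A* are trivial,
    the words with three letters of one kind express associativity of the two given
    products, the word A A A* A* expresses the compatibility of Delta with the
    product, and A A* A A* expresses the antisymmetry axiom ([bowtie_assocP],
    [ASI_bialgebraP]).  Finally the two derivation rules for the action of A on
    A*, paired with A, are the two admissibility identities of the algebra, and
    those for the action of A* on A, paired with A*, are the two admissibility
    identities of the coalgebra ([diff_repA_admissible],
    [diff_repB_admissible]); coassociativity and the rule for Delta eth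
    transpose the differential algebra axioms of A*. *)

(** * Matched pairs as associative bowtie products *)

Section MatchedPairs.

Variables (k : fieldType) (A B : vectType k).
Variables (dotA : 'Hom(A, 'End(A))) (dotB : 'Hom(B, 'End(B))).
Variables (lA rA : 'Hom(A, 'End(B))) (lB rB : 'Hom(B, 'End(A))).

Local Notation bt := (bowtie dotA dotB lA rA lB rB).

Lemma bowtie_inl x y : bt (x, 0) (y, 0) = (dotA x y, 0).
Proof. by rewrite /bowtie /= !(linear0, zero_lfunE, addr0). Qed.

Lemma bowtie_inr a b : bt (0, a) (0, b) = (0, dotB a b).
Proof. by rewrite /bowtie /= !(linear0, zero_lfunE, addr0). Qed.

Lemma bowtie_inlr x b : bt (x, 0) (0, b) = (rB b x, lA x b).
Proof. by rewrite /bowtie /= !(linear0, zero_lfunE, addr0, add0r). Qed.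

Lemma bowtie_inrl a y : bt (0, a) (y, 0) = (lB a y, rA y a).
Proof. by rewrite /bowtie /= !(linear0, zero_lfunE, addr0, add0r). Qed.

Let add3_linear (V : lmodType k) (c : k) (u1 u2 u3 v1 v2 v3 : V) :
  (c *: u1 + v1) + (c *: u2 + v2) + (c *: u3 + v3) =
  c *: (u1 + u2 + u3) + (v1 + v2 + v3).
Proof. by rewrite [X in X + _ = _]addrACA [LHS]addrACA !scalerDr. Qed.

Lemma bowtie_linearr p : linear (bt p).
Proof.
move=> c q r; rewrite /bowtie /=; congr (_, _);
  rewrite !linearP !(add_lfunE, scale_lfunE); exact: add3_linear.
Qed.

Lemma bowtie_linearl q : linear (bt^~ q).
Proof.
move=> c p r; rewrite /bowtie /=; congr (_, _);
  rewrite !linearP !(add_lfunE, scale_lfunE); exact: add3_linear.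
Qed.

(** The B-component of a product of two elements of A and one of B only sees
    the actions of A, so associativity of the words A A B, B A A and A B A is
    exactly the list of bimodule axioms. *)
Lemma bowtie_rep_r : associative bt -> is_rep dotA lA rA.
Proof.
move=> btA; split=> x y; apply/lfunP=> b; rewrite !comp_lfunE.
- have /(congr1 snd) := btA (x, 0) (y, 0) (0, b).
  by rewrite bowtie_inl !bowtie_inlr /= !(linear0, zero_lfunE, add0r, addr0).
- have /(congr1 snd) := btA (0, b) (x, 0) (y, 0).
  by rewrite bowtie_inl !bowtie_inrl /= !(linear0, zero_lfunE, add0r).
- have /(congr1 snd) := btA (x, 0) (0, b) (y, 0).
  rewrite bowtie_inlr !bowtie_inrl /=.
  by rewrite !(linear0, zero_lfunE, add0r, addr0).
Qed.

Lemma bowtie_rep_l : associative bt -> is_rep dotB lB rB.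
Proof.
move=> btA; split=> a b; apply/lfunP=> x; rewrite !comp_lfunE.
- have /(congr1 fst) := btA (0, a) (0, b) (x, 0).
  rewrite bowtie_inr !bowtie_inrl /=.
  by rewrite !(linear0, zero_lfunE, add0r, addr0) => ->.
- have /(congr1 fst) := btA (x, 0) (0, a) (0, b).
  by rewrite bowtie_inr !bowtie_inlr /= !(linear0, zero_lfunE, add0r, addr0).
- have /(congr1 fst) := btA (0, a) (x, 0) (0, b).
  rewrite bowtie_inlr !bowtie_inrl /=.
  by rewrite !(linear0, zero_lfunE, add0r, addr0).
Qed.

(** The bimodule axioms in a matched pair are part of the associativity of the
    bowtie product. *)
Lemma matched_pairP : is_algebra dotA -> is_algebra dotB ->
  is_matched_pair dotA dotB lA rA lB rB <-> associative bt.
Proof.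
move=> hA hB; split=> [[]//|btA].
by split=> //; [apply: bowtie_rep_l | apply: bowtie_rep_r].
Qed.

(** The derivation rule on a product of an element of A and one of B splits into
    one rule for an action of A and one for an action of B; on products inside A
    or inside B it is the rule assumed there. *)
Lemma bowtie_derivationP (lambda : k) (dA : 'End(A)) (dB : 'End(B)) :
  is_diff_algebra lambda dotA dA -> is_diff_algebra lambda dotB dB ->
  associative bt ->
  (is_diff_rep lambda dotA dA lA rA dB /\ is_diff_rep lambda dotB dB lB rB dA)
  <-> (forall p q, dsum dA dB (bt p q) =
        bt (dsum dA dB p) q + bt p (dsum dA dB q)
        + lambda *: bt (dsum dA dB p) (dsum dA dB q)).
Proof.
move=> [_ hA] [_ hB] btA; split=> [[[_ hl hr] [_ hl' hr']] p q|h].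
  rewrite !dsumE /bowtie /=; congr (_, _).
    rewrite 2!linearD /= hA hl' hr' !scalerDr.
    (* regroup by term of the derivation rule rather than by product *)
    exact: (AC (3*3*3) (1*5*7*(2*4*8)*(3*6*9))).
  rewrite 2!linearD /= hB hl hr !scalerDr.
  exact: (AC (3*3*3) (1*4*8*(2*5*7)*(3*6*9))).
have d0l x : dsum dA dB (x, 0) = (dA x, 0) by rewrite dsumE /= linear0.
have d0r b : dsum dA dB (0, b) = (0, dB b) by rewrite dsumE /= linear0.
have hlr x b := h (x, 0) (0, b); have hrl b x := h (0, b) (x, 0).
split; split; try exact: bowtie_rep_l; try exact: bowtie_rep_r.
- by move=> x v; have := hlr x v;
    rewrite d0l d0r !bowtie_inlr dsumE => /(congr1 snd).
- move=> x v; have := hrl v x.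
  rewrite d0l d0r !bowtie_inrl dsumE => /(congr1 snd) /= ->.
  by rewrite [X in X + _]addrC.
- by move=> b x; have := hrl b x;
    rewrite d0l d0r !bowtie_inrl dsumE => /(congr1 fst).
- move=> b x; have := hlr x b.
  rewrite d0l d0r !bowtie_inlr dsumE => /(congr1 fst) /= ->.
  by rewrite [X in X + _]addrC.
Qed.

End MatchedPairs.

(** * The pairing form on A + A* *)

Lemma dual_sep (k : fieldType) (A : vectType k) (x y : A) :
  (forall u : dual A, u x = u y) -> x = y.
Proof.
move=> h; have /lker0P ev_inj := ev_lker0 A; apply: ev_inj.
by apply/lfunP=> u; rewrite !evE.
Qed.

Lemma Bd_sym (k : fieldType) (A : vectType k) (p q : A * dual A) :
  Bd p q = Bd q p.
Proof. exact: addrC. Qed.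

Lemma Bd_nondegenerate (k : fieldType) (A : vectType k) (p q : A * dual A) :
  (forall r, Bd p r = Bd q r) -> p = q.
Proof.
case: p q => [x a] [y b] h; congr (_, _).
  by apply: dual_sep => u; have := h (0, u); rewrite /Bd /= !linear0 !addr0.
by apply/lfunP=> z; have := h (z, 0); rewrite /Bd /= !zero_lfunE !add0r.
Qed.

(** * The double of A and A* *)

Section Double.

Variables (k : fieldType) (A : vectType k).
Variables (dot : 'Hom(A, 'End(A))) (circ : 'Hom(dual A, 'End(dual A))).

(* The four actions are kept abstract: they are determined by these pairings,
   and working from the pairings alone also keeps the transports through the
   bidual out of sight. *)
Variables (lA rA : 'Hom(A, 'End(dual A))) (lB rB : 'Hom(dual A, 'End(A))).
Hypothesis pair_lA : forall x (a : dual A) y, lA x a y = a (dot y x).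
Hypothesis pair_rA : forall x (a : dual A) y, rA x a y = a (dot x y).
Hypothesis pair_lB : forall a x (b : dual A), b (lB a x) = circ b a x.
Hypothesis pair_rB : forall a x (b : dual A), b (rB a x) = circ a b x.

Local Notation bt := (bowtie dot circ lA rA lB rB).

(** The dual actions are chosen to make this hold: both sides expand into the
    same six evaluations, one for each cyclically adjacent pair of arguments and
    each of the two products. *)
Lemma bowtie_invariant p q r : Bd (bt p q) r = Bd p (bt q r).
Proof.
case: p q r => [x a] [y b] [z c]; rewrite /Bd /bowtie /=.
rewrite !linearD /= !add_lfunE !(pair_lA, pair_rA, pair_lB, pair_rB).
by ring.
Qed.

Lemma homog_decomp (r : A * dual A) : r = (r.1, 0) + (0, r.2).
Proof. by case: r => x a; congr (_, _); rewrite /= ?addr0 ?add0r. Qed.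

Lemma Bd_addr (p q r : A * dual A) : Bd p (q + r) = Bd p q + Bd p r.
Proof. rewrite /Bd /= !linearD !add_lfunE; exact: addrACA. Qed.

(** Cyclicity of Bd (u v) w moves two arguments from the same summand into the
    product, where it is prescribed; nondegeneracy of Bd then determines the
    mixed products. *)
Lemma double_construction_bowtie star :
  is_double_construction dot circ star -> forall p q, star p q = bt p q.
Proof.
move=> [_ sA sB inv] p q.
have cyc u v w : Bd (star u v) w = Bd (star w u) v.
  by rewrite inv Bd_sym inv Bd_sym.
have btcyc u v w : Bd (bt u v) w = Bd (bt w u) v.
  by rewrite bowtie_invariant Bd_sym bowtie_invariant Bd_sym.
have sAB x b : star (x, 0) (0, b) = bt (x, 0) (0, b).
  apply: Bd_nondegenerate => r; rewrite (homog_decomp r) !Bd_addr.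
  congr (_ + _).
    by rewrite cyc btcyc sA bowtie_inl.
  by rewrite inv bowtie_invariant sB bowtie_inr.
have sBA a y : star (0, a) (y, 0) = bt (0, a) (y, 0).
  apply: Bd_nondegenerate => r; rewrite (homog_decomp r) !Bd_addr.
  congr (_ + _).
    by rewrite inv bowtie_invariant sA bowtie_inl.
  by rewrite cyc btcyc sB bowtie_inr.
rewrite [in LHS](homog_decomp p) [in LHS](homog_decomp q).
rewrite !linearD /= !add_lfunE.
rewrite sA sB sAB sBA bowtie_inlr bowtie_inrl /bowtie /=.
congr (_, _); rewrite /= ?addr0 ?add0r; first exact: addrAC.
exact: (AC (1*2) (3*2*1)).
Qed.

Lemma bowtie_star p q : bilfun bt p q = bt p q.
Proof.
by apply: bilfunE; [exact: bowtie_linearr | exact: bowtie_linearl].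
Qed.

(** Invariance turns the two bracketings of p q r, paired with s, into
    Bd (p q) (r s) and Bd (q r) (s p). *)
Lemma bowtie_assoc_cyclic :
  associative bt <->
  forall p q r s, Bd (bt p q) (bt r s) = Bd (bt q r) (bt s p).
Proof.
have E p q r s : Bd (bt p (bt q r)) s = Bd (bt q r) (bt s p).
  by rewrite bowtie_invariant Bd_sym bowtie_invariant.
split=> [btA p q r s|cyc p q r]; first by rewrite -bowtie_invariant -btA E.
by apply: Bd_nondegenerate => s; rewrite E [RHS]bowtie_invariant [RHS]cyc.
Qed.

(** The two identities are the cyclic symmetry of Bd (p q) (r s) on the words
    A A A* A* and A A* A A*; associativity of the two products accounts for the
    remaining words, and multilinearity for general arguments. *)
Lemma bowtie_assocP : is_algebra dot -> is_algebra circ ->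
  associative bt <->
  (forall x y a b, circ a b (dot x y) = circ a (rA x b) y + circ (lA y a) b x)
  /\ (forall x y a b, circ a (lA y b) x + circ b (lA x a) y
                      = circ (rA x b) a y + circ (rA y a) b x).
Proof.
move=> hA hB; apply: (iff_trans bowtie_assoc_cyclic); split=> [cyc|].
  split=> x y a b.
    have := cyc (x, 0) (y, 0) (0, a) (0, b).
    rewrite bowtie_inl bowtie_inr bowtie_inlr bowtie_inrl /Bd /=.
    by rewrite linear0 addr0 pair_rB pair_lB.
  have := cyc (x, 0) (0, a) (y, 0) (0, b).
  rewrite !bowtie_inlr !bowtie_inrl /Bd /= !pair_rB !pair_lB.
  exact.
move=> [H3 H4] [x1 a1] [x2 a2] [x3 a3] [x4 a4].
rewrite /Bd /bowtie /= !linearD /= !add_lfunE.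
(* The actions on A are paired off first: [pair_lA] and [pair_rA] would also
   apply to an element of A* evaluated at a value of lB or rB, and would then
   hide the products of A* that the identities are about. *)
rewrite !(pair_lB, pair_rB) !(pair_lA, pair_rA).
rewrite (H3 x1 x2) (H3 x2 x3) (H3 x3 x4) (H3 x4 x1).
rewrite (hA x1 x2 x3) (hA x2 x3 x4) (hA x3 x4 x1) (hA x4 x1 x2).
rewrite (hB a1 a2 a3) (hB a2 a3 a4) (hB a3 a4 a1) (hB a4 a1 a2).
(* The alternating words occur twice, starting in A or in A*. *)
have /eqP := H4 x1 x3 a2 a4; rewrite -subr_eq => /eqP <-.
have /eqP := H4 x2 x4 a3 a1; rewrite -subr_eq => /eqP <-.
by ring.
Qed.

Local Notation Delta := (linear_dual circ).

Lemma pair_Delta x a b : Delta x a b = circ a b x.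
Proof. by rewrite -tpairE linear_dualE. Qed.

Lemma transp_rmult x a : transp (rmult dot x) a = lA x a.
Proof. by apply/lfunP=> y; rewrite transpE rmultE pair_lA. Qed.

Lemma transp_lmult x a : transp (lmult dot x) a = rA x a.
Proof. by apply/lfunP=> y; rewrite transpE pair_rA. Qed.

Lemma transp_id a : transp (\1 : 'End(A)) a = a.
Proof. by apply/lfunP=> y; rewrite transpE id_lfunE. Qed.

(** Enough tests because the pure tensors [tpair v w] span the dual of the
    tensor square. *)
Lemma tensor3_sep (S T : tensor A (tensor A A)) :
  (forall u v w, S u (tpair v w) = T u (tpair v w)) -> S = T.
Proof.
move=> h; apply/lfunP=> u; apply/lfunP=> z; rewrite (dual_tens_decomp z).
rewrite !linear_sum; apply: eq_bigr => i _; rewrite !linear_sum.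
by apply: eq_bigr => j _; rewrite !linearZ /= h.
Qed.

(** Evaluated at a, b, c, the two iterated coproducts of x are the two
    bracketings of a b c evaluated at x. *)
Lemma linear_dual_coalgebra : is_algebra circ -> is_coalgebra Delta.
Proof.
move=> hB x; apply: tensor3_sep => a b c.
have tD u v : transp Delta (tpair u v) = circ u v.
  by apply/lfunP=> y; rewrite transpE linear_dualE.
by rewrite tassocE !tmapE !tD !transp_id !pair_Delta hB.
Qed.

Lemma tensor_sep (S T : tensor A A) : (forall u v, S u v = T u v) -> S = T.
Proof. by move=> h; apply/lfunP=> u; apply/lfunP=> v. Qed.

Lemma tensor_addE (S T : tensor A A) u v : (S + T) u v = S u v + T u v.
Proof. by rewrite add_lfunE add_lfunE. Qed.

Lemma tensor_scaleE c (S : tensor A A) u v : (c *: S) u v = c * S u v.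
Proof. by rewrite scale_lfunE scale_lfunE. Qed.

Lemma tensor_subE (f g : 'End(tensor A A)) T u v :
  (f - g) T u v = f T u v - g T u v.
Proof. by rewrite add_lfunE tensor_addE !opp_lfunE. Qed.

Let pD := (transp_rmult, transp_lmult, transp_id, pair_Delta).

(** Evaluated on pairs of forms, the compatibility and antisymmetry axioms are
    the two identities of [bowtie_assocP]. *)
Lemma ASI_bialgebraP : is_algebra dot -> is_algebra circ ->
  is_ASI_bialgebra dot Delta <-> associative bt.
Proof.
move=> hA hB; apply: iff_trans (iff_sym (bowtie_assocP hA hB)).
have E3 x y a b : (Delta (dot x y) a b = circ a b (dot x y)) *
   ((tmap (rmult dot y) \1 (Delta x) + tmap \1 (lmult dot x) (Delta y)) a b
     = circ (lA y a) b x + circ a (rA x b) y).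
  by rewrite tensor_addE !tmapE !pD.
have E4 x y a b :
  (((tmap (lmult dot x) \1 - tmap \1 (rmult dot x)) (Delta y)) b a
     = circ (rA x b) a y - circ b (lA x a) y) *
  ((tswap A A
          ((tmap \1 (rmult dot y) - tmap (lmult dot y) \1) (Delta x))) b a
     = circ a (lA y b) x - circ (rA y a) b x).
  split; first by rewrite tensor_subE !tmapE !pD.
  by rewrite tswapE tensor_subE !tmapE !pD.
split=> [[_ _ h3 h4]|[h3 h4]].
  split=> x y a b; first by rewrite -E3 h3 E3 addrC.
  have : circ (rA x b) a y - circ b (lA x a) y
         = circ a (lA y b) x - circ (rA y a) b x.
    by rewrite -!E4 h4.
  by move/eqP; rewrite subr_eq addrAC eq_sym subr_eq => /eqP.
split=> // [|x y|x y]; first exact: linear_dual_coalgebra.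
  by apply: tensor_sep => a b; rewrite !E3 h3 addrC.
apply: tensor_sep => b a; rewrite !E4; apply/eqP.
by rewrite subr_eq addrAC eq_sym subr_eq h4.
Qed.

(** * Derivations and admissibility *)

Section Differential.

Variables (lambda : k) (d eth : 'End(A)).

(** Each rule for an action of A on A*, evaluated at a point of A, is the value
    of an arbitrary form on one admissibility identity. *)
Lemma diff_repA_admissible : is_rep dot lA rA ->
  is_diff_rep lambda dot d lA rA (transp eth) <->
  (forall x y, dot (eth x) y =
     dot x (d y) + eth (dot x y) + lambda *: eth (dot x (d y))) /\
  (forall x y, dot x (eth y) =
     dot (d x) y + eth (dot x y) + lambda *: eth (dot (d x) y)).
Proof.
have El x a y :
  (transp eth (lA y a) x = a (dot (eth x) y)) *
  ((lA (d y) a + lA y (transp eth a) + lambda *: lA (d y) (transp eth a)) x =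
   a (dot x (d y) + eth (dot x y) + lambda *: eth (dot x (d y)))).
  rewrite transpE !add_lfunE scale_lfunE !pair_lA !transpE.
  by rewrite 2!(linearD a) linearZ.
have Er x a y :
  (transp eth (rA x a) y = a (dot x (eth y))) *
  ((rA (d x) a + rA x (transp eth a) + lambda *: rA (d x) (transp eth a)) y =
   a (dot (d x) y + eth (dot x y) + lambda *: eth (dot (d x) y))).
  rewrite transpE !add_lfunE scale_lfunE !pair_rA !transpE.
  by rewrite 2!(linearD a) linearZ.
move=> hr; split=> [[_ hl' hr']|[hl' hr']].
  split=> x y; apply: dual_sep => a; first by rewrite -El hl' El.
  by rewrite -Er hr' Er.
split=> // x a; apply/lfunP=> y; first by rewrite !El hl'.
by rewrite !Er hr'.
Qed.

(** Each rule for an action of A* on A, paired with a second form, is the value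
    of one coalgebra identity on an arbitrary pair of forms. *)
Lemma diff_repB_admissible : is_rep circ lB rB ->
  is_diff_rep lambda circ (transp eth) lB rB d <->
  (forall x, tmap d \1 (Delta x) =
     tmap \1 eth (Delta x) + Delta (d x)
     + lambda *: tmap \1 eth (Delta (d x))) /\
  (forall x, tmap \1 d (Delta x) =
     tmap eth \1 (Delta x) + Delta (d x)
     + lambda *: tmap eth \1 (Delta (d x))).
Proof.
have El x (a b : dual A) :
  (b (d (lB a x)) = tmap d \1 (Delta x) b a) *
  (b (lB (transp eth a) x + lB a (d x) + lambda *: lB (transp eth a) (d x)) =
   (tmap \1 eth (Delta x) + Delta (d x)
     + lambda *: tmap \1 eth (Delta (d x))) b a).
  rewrite 2!(linearD b) linearZ /= !pair_lB !tensor_addE tensor_scaleE !tmapE.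
  by rewrite !pD -transpE pair_lB.
have Er x (a b : dual A) :
  (b (d (rB a x)) = tmap \1 d (Delta x) a b) *
  (b (rB (transp eth a) x + rB a (d x) + lambda *: rB (transp eth a) (d x)) =
   (tmap eth \1 (Delta x) + Delta (d x)
     + lambda *: tmap eth \1 (Delta (d x))) a b).
  rewrite 2!(linearD b) linearZ /= !pair_rB !tensor_addE tensor_scaleE !tmapE.
  by rewrite !pD -transpE pair_rB.
move=> hr; split=> [[_ hl' hr']|[hl' hr']].
  split=> x; apply: tensor_sep => a b; first by rewrite -!El hl'.
  by rewrite -!Er hr'.
split=> // a x; apply: dual_sep => b; first by rewrite !El hl'.
by rewrite !Er hr'.
Qed.

Lemma linear_dual_diff_coalgebra :
  is_diff_algebra lambda circ (transp eth) ->
  is_diff_coalgebra lambda Delta eth.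
Proof.
move=> [hB hd]; split=> [|x]; first exact: linear_dual_coalgebra.
apply: tensor_sep => a b; rewrite 2!tensor_addE tensor_scaleE !tmapE !pD.
by rewrite -transpE hd !add_lfunE scale_lfunE.
Qed.

Lemma diff_matched_pair_ASI :
  is_diff_algebra lambda dot d -> is_diff_algebra lambda circ (transp eth) ->
  is_diff_matched_pair lambda dot d circ (transp eth) lA rA lB rB <->
  is_diff_ASI_bialgebra lambda dot Delta d eth.
Proof.
move=> hA hB; have [hA0 _] := hA; have [hB0 _] := hB.
split=> [[_ _ [_ _ rB_rep rA_rep btA] dA dB]|].
  have [a1 a2] := (diff_repA_admissible rA_rep).1 dA.
  have [c1 c2] := (diff_repB_admissible rB_rep).1 dB.
  split; first exact/ASI_bialgebraP.
    by split.
  by split=> //; apply: linear_dual_diff_coalgebra.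
move=> [/(ASI_bialgebraP hA0 hB0) btA [_ a1 a2] [_ c1 c2]].
have rB_rep := bowtie_rep_l btA; have rA_rep := bowtie_rep_r btA.
have mp := (matched_pairP lA rA lB rB hA0 hB0).2 btA.
split=> //.
  exact/(diff_repA_admissible rA_rep).
exact/(diff_repB_admissible rB_rep).
Qed.

Lemma diff_matched_pair_double :
  is_diff_algebra lambda dot d -> is_diff_algebra lambda circ (transp eth) ->
  is_diff_matched_pair lambda dot d circ (transp eth) lA rA lB rB <->
  exists star, is_diff_double_construction lambda dot d circ (transp eth) star.
Proof.
move=> hA hB; have [hA0 _] := hA; have [hB0 _] := hB.
split=> [[_ _ [_ _ _ _ btA] dA dB]|[star [hs [sA sD]]]].
  have starA : is_algebra (bilfun bt) by move=> p q r; rewrite !bowtie_star.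
  exists (bilfun bt); split; split=> //.
  - by move=> x y; rewrite bowtie_star bowtie_inl.
  - by move=> a b; rewrite bowtie_star bowtie_inr.
  - by move=> p q r; rewrite !bowtie_star bowtie_invariant.
  by move=> p q; rewrite !bowtie_star; move: p q; apply/bowtie_derivationP.
have sE := double_construction_bowtie hs.
have btA : associative bt by move=> p q r; rewrite -!sE sA.
have [dA dB] : is_diff_rep lambda dot d lA rA (transp eth) /\
    is_diff_rep lambda circ (transp eth) lB rB d.
  by apply/(bowtie_derivationP hA hB btA) => p q; rewrite -!sE sD.
have mp := (matched_pairP lA rA lB rB hA0 hB0).2 btA.
by split.
Qed.

End Differential.

End Double.

Theorem corollary5p24 (k : fieldType) (hk : [pchar k] =i pred0) (lambda : k)
  (A : vectType k) (dot : 'Hom(A, 'End(A))) (d : 'End(A))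
  (hA : is_diff_algebra lambda dot d)
  (eth : 'End(A)) (circ : 'Hom(dual A, 'End(dual A)))
  (hA' : is_diff_algebra lambda circ (transp eth)) :
  let a := is_diff_matched_pair lambda dot d circ (transp eth)
    (dual_rep (rmult dot)) (dual_rep (lmult dot))
    (of_bidual (dual_rep (rmult circ))) (of_bidual (dual_rep (lmult circ))) in
  let b := exists star : 'Hom((A * dual A)%type, 'End((A * dual A)%type)),
    is_diff_double_construction lambda dot d circ (transp eth) star in
  let c := is_diff_ASI_bialgebra lambda dot (linear_dual circ) d eth in
  (a <-> b) /\ (b <-> c).
Proof.
have pair_lA x (a : dual A) y : dual_rep (rmult dot) x a y = a (dot y x).
  by rewrite dual_repE rmultE.
have pair_rA x (a : dual A) y : dual_rep (lmult dot) x a y = a (dot x y).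
  by rewrite dual_repE.
have pair_lB a x (b : dual A) :
    b (of_bidual (dual_rep (rmult circ)) a x) = circ b a x.
  by rewrite of_bidual_dualE rmultE.
have pair_rB a x (b : dual A) :
    b (of_bidual (dual_rep (lmult circ)) a x) = circ a b x.
  by rewrite of_bidual_dualE.
move=> a b c.
have ab : a <-> b :=
  diff_matched_pair_double pair_lA pair_rA pair_lB pair_rB hA hA'.
have ac : a <-> c :=
  diff_matched_pair_ASI pair_lA pair_rA pair_lB pair_rB hA hA'.
by split=> //; apply: (iff_trans (iff_sym ab)).
Qed.
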